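(* Let $0\le a,b,c,h\le n$ with $a+b+c=n$. If $c\le n-h$, $a\ge1$ and $(a-1,b+1,c)\ne(0,h,n-h)$, then $$D_{n,h}(a,b,c)-D_{n,h}(a-1,b+1,c)=-(-q)^{2n-h-1-b-2c}D_{n-1,h-1}(a-1,b,c).$$
   Context: $q$ is a power of an odd prime. Put $P(k)=\prod_{l=1}^{k}(1-(-q)^{-l})$ (empty products $=1$, empty sums $=0$). For nonnegative integers $a,b,c$ and integer $j$: if $a+b>0$, $\mathcal C_j(a,b,c)=(-1)^{j+1}\prod_{i=1}^{a+b-1}(1-(-q)^i)$; and $\mathcal C_j(0,0,c)=\sum_{l=1}^{c}\frac1{(-q)^l-1}$. Let $M_{n,h}(a,b,c,i,s)=(-q)^{n(h-i)+\frac{(i-s)(2n-i+s+1)}{2}-h^2+s(2n-2c-s)}(-1)^{i+h}\frac{P(n-i)}{P(n-h)P(h)}\cdot\frac{\prod_{l=s+1}^{h}(1-(-q)^{-l})}{P(h-i)P(i-s)}\cdot\frac{P(c)P(b)}{P(c-i+s)P(b-s)}\cdot\mathcal C_{h+1-s}(a,b-s,c+s-i)$. For nonnegative $a,b,c$ with $a+b+c=n$, define $D_{n,h}(a,b,c)=\sum_{0\le s\le\min(h,b)}\sum_{s\le i\le\min(s+c,h)}M_{n,h}(a,b,c,i,s)$ when $(a,b,c)\ne(0,t,n-t)$ with $t\le h-1$; and for $(a,b,c)=(0,t,n-t)$ with $t\le h-1$, $t\equiv h+1\pmod 2$, define $D_{n,h}(0,t,n-t)$ as the same double sum plus $\frac{(-q)^{-(h-t)(h+t+1)/2}}{1-(-q)^{-(h-t)}}$.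 (When $h-1<0$, the double sum defining $D_{n-1,h-1}$ is empty, hence $0$.) *)

(* Defs.v *)
From mathcomp Require Import all_boot all_order all_algebra.

Set Implicit Arguments.
Unset Strict Implicit.
Unset Printing Implicit Defensive.

Import Order.TTheory GRing.Theory Num.Theory.
Local Open Scope ring_scope.

Definition mq (q : nat) : rat := - q%:R.

Definition P (q k : nat) : rat := \prod_(1 <= l < k.+1) (1 - mq q ^- l).

Definition C (q : nat) (j : int) (a b c : nat) : rat :=
  if (0 < a + b)%N then
    (-1) ^ (j + 1) * \prod_(1 <= i < a + b) (1 - mq q ^+ i)
  else \sum_(1 <= l < c.+1) (mq q ^+ l - 1)^-1.

(* The exponents are computed in int, and both halvings in this file are exact.
   The truncated nat subtractions are used only in the summation range of Dsum
   (with h <= n), where s <= i <= h <= n, i <= s + c and s <= b. *)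
Definition Mexp (n h c i s : nat) : int :=
  n%:Z * (h%:Z - i%:Z)
  + (((i%:Z - s%:Z) * (2 * n%:Z - i%:Z + s%:Z + 1)) %/ 2)%Z
  - h%:Z ^+ 2
  + s%:Z * (2 * n%:Z - 2 * c%:Z - s%:Z).

Definition M (q n h a b c i s : nat) : rat :=
  mq q ^ Mexp n h c i s
  * (-1) ^+ (i + h)
  * (P q (n - i) / (P q (n - h) * P q h))
  * ((\prod_(s.+1 <= l < h.+1) (1 - mq q ^- l)) / (P q (h - i) * P q (i - s)))
  * ((P q c * P q b) / (P q (c - (i - s)) * P q (b - s)))
  * C q (h%:Z + 1 - s%:Z) a (b - s) (c + s - i).

Definition Dsum (q n h a b c : nat) : rat :=
  \sum_(0 <= s < (minn h b).+1)
    \sum_(s <= i < (minn (s + c) h).+1) M q n h a b c i s.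

Definition Dcorr (q h t : nat) : rat :=
  mq q ^ (- (((h%:Z - t%:Z) * (h%:Z + t%:Z + 1)) %/ 2)%Z)
  / (1 - mq q ^- (h - t)).

(* D_{n,h}(a,b,c), meaningful for a + b + c = n, so that the condition
   (a,b,c) = (0,t,n-t) with t <= h-1 reads a = 0 and b < h.
   The index h is an int because D_{n-1,h-1} is needed at h = 0, where the
   double sum is empty.
   D_{n,h}(0,t,n-t) is not defined for t <= h-1 with t = h mod 2; the value
   given to it here (the bare double sum) is a dummy one. *)
Definition D (q n : nat) (h : int) (a b c : nat) : rat :=
  match h with
  | Posz h' =>
      Dsum q n h' a b c
      + (if [&& a == 0%N, (b < h')%N & odd (h' - b)] then Dcorr q h' b else 0)
  | Negz _ => 0
  end.

(* Main.v *)
Require Import Defs.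
From mathcomp Require Import all_boot all_order all_algebra.
From mathcomp Require Import zify ring.

Import Order.TTheory GRing.Theory Num.Theory.
Local Open Scope ring_scope.

(** Under the hypotheses neither the correction terms nor the harmonic branch of
    [C] occur, and [C] depends on [a] and [b] only through [a + b].  Hence
    [D(a,b,c)] and [D(a-1,b+1,c)] differ, term by term, only in the factor
    [P b / P (b - s)], and with [x = -q]
    [P b / P (b - s) - P (b+1) / P (b+1-s)
       = - x^(-(b+1-s)) (1 - x^(-s)) P b / P (b+1-s)].
    This vanishes at [s = 0]; the term of index [(s+1, i+1)] of the difference
    is the term of index [(s, i)] of [D_{n-1,h-1}(a-1,b,c)], up to the factor of
    the statement. *)

Section TermIdentity.

Variable q : nat.
Hypothesis q_gt1 : (1 < q)%N.

Local Notation x := (mq q).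

Lemma mq_neq0 : x != 0.
Proof. by rewrite oppr_eq0 pnatr_eq0 -lt0n ltnW. Qed.

Lemma one_sub_mqVn_neq0 l : (0 < l)%N -> 1 - x ^- l != 0.
Proof.
move=> l_gt0; rewrite subr_eq0 eq_sym invr_eq1.
apply/eqP => /(congr1 Num.norm); rewrite normrX normrN normr1 normr_nat.
by apply/eqP; rewrite -natrX pnatr_eq1 -(expn0 q) eqn_exp2l // -lt0n.
Qed.

Lemma PS k : P q k.+1 = P q k * (1 - x ^- k.+1).
Proof. by rewrite /P big_nat_recr. Qed.

Lemma P_neq0 k : P q k != 0.
Proof.
elim: k => [|k IHk]; first by rewrite /P big_nil oner_eq0.
by rewrite PS mulf_neq0 ?one_sub_mqVn_neq0.
Qed.

Lemma prod_P s h : (s <= h)%N ->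
  \prod_(s.+1 <= l < h.+1) (1 - x ^- l) = P q h / P q s.
Proof.
move=> le_sh; have -> : P q h = P q s * \prod_(s.+1 <= l < h.+1) (1 - x ^- l).
  by rewrite /P -big_cat_nat.
by rewrite mulrAC divff ?mul1r // P_neq0.
Qed.

Lemma C_addE j a b c a' b' c' : (0 < a + b)%N -> (a + b = a' + b')%N ->
  C q j a b c = C q j a' b' c'.
Proof. by rewrite /C => + <-; case: ifP. Qed.

(* The cutoff makes the summand vanish for [s > b], where [b - s] in [M] is
   truncated. *)
Definition Mcut n h a b c i s : rat :=
  if (s <= b)%N then M q n h a b c i s else 0.

(** This makes the range of [s] independent of [b], so that the sums for [b] and [b.+1] can be
    subtracted term by term. *)
Lemma Dsum_cut n h a b c :
  Dsum q n h a b c =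
  \sum_(0 <= s < h.+1) \sum_(s <= i < (minn (s + c) h).+1) Mcut n h a b c i s.
Proof.
rewrite /Dsum [RHS](@big_cat_nat _ _ _ (minn h b).+1) //=; last first.
  by rewrite ltnS geq_minl.
rewrite [X in _ = _ + X]big1_seq ?addr0 => [|s]; last first.
  rewrite mem_index_iota => /andP[_ s_bnd]; apply: big1 => i _.
  by rewrite /Mcut leqNgt ifF //; apply/negbTE; lia.
apply: eq_big_nat => s s_bnd; apply: eq_bigr => i _.
by rewrite /Mcut ifT //; lia.
Qed.


Lemma MexpSS n h c i s :
  Mexp n.+1 h.+1 c i.+1 s.+1 =
  Mexp n h c i s + 2 * n%:Z - h%:Z - 2 * c%:Z - s%:Z.
Proof.
rewrite /Mexp.
set e1 := (X in ((X %/ 2)%Z)).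
set e2 := (X in _ = _ + ((X %/ 2)%Z) - _ + _ + _ - _ - _ - _).
(* The two numerators differ by an explicit even number, so the floor quotients compare without any
   parity argument. *)
have -> : e1 = (i%:Z - s%:Z) * 2 + e2 by rewrite /e1 /e2; lia.
rewrite divzMDl //; move: (e2 %/ 2)%Z => e; rewrite expr2; nia.
Qed.

(** An analogue of the falling factorial: the product of [1 - x ^- l] over [b - s < l <= b]. For
    [s > b] it would contain the factor at [l = 0], whence the value 0. *)
Definition Pfall b s : rat := if (s <= b)%N then P q b / P q (b - s) else 0.

Lemma Pfall0 b : Pfall b 0 = 1.
Proof. by rewrite /Pfall subn0 divff ?P_neq0. Qed.

(** Both terms are multiples of [Pfall b s], by [1 - x ^- (b - s)] and [1 - x ^- b.+1] when
    [s <= b]; for [s > b] everything vanishes. *)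
Lemma Pfall_diff b s :
  Pfall b s.+1 - Pfall b.+1 s.+1 =
  - x ^- (b - s) * (1 - x ^- s.+1) * Pfall b s.
Proof.
have Pn0 := P_neq0; have x0 := mq_neq0; rewrite /Pfall ltnS.
have [lt_sb|lt_bs|->] := ltngtP s b.
- have -> : (b = (b - s.+1) + s.+1)%N by lia.
  set d := (b - s.+1)%N.
  rewrite subSS addnK (_ : (d + s.+1 - s = d.+1)%N); last lia.
  rewrite !PS (_ : x ^- (d + s.+1).+1 = x ^- d.+1 * x ^- s.+1); last first.
    by rewrite -invfM -exprD addSn.
  have := one_sub_mqVn_neq0 d.+1 isT; have := Pn0 d.
  move: (x ^- d.+1) => v Pd v1; field; by rewrite v1 Pd expf_neq0.
- by rewrite subr0 mulr0.
- rewrite subSS subnn expr0 invr1 PS; have P0 := Pn0 0%N.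
  by field; rewrite P0 expf_neq0.
Qed.

Lemma McutE n h a b c i s : (s <= h)%N ->
  Mcut n h a b c i s =
  x ^ Mexp n h c i s * (-1) ^+ (i + h)
  * (P q (n - i) * P q c
     / (P q (n - h) * P q s * P q (h - i) * P q (i - s) * P q (c - (i - s))))
  * C q (h%:Z + 1 - s%:Z) a (b - s) (c + s - i) * Pfall b s.
Proof.
move=> le_sh; have Pn0 := P_neq0; rewrite /Mcut /Pfall.
case: ifP => _; last by rewrite mulr0.
rewrite /M prod_P //; field; do ?[apply/andP; split]; exact: Pn0.
Qed.

Lemma Mcut_s0 n h a b c i :
  Mcut n h a.+1 b c i 0 = Mcut n h a b.+1 c i 0.
Proof.
rewrite !McutE // !Pfall0 !subn0.
by rewrite (@C_addE _ a.+1 b _ a b.+1 (c + 0 - i)) //; lia.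
Qed.

Lemma Mcut_diff n h a b c i s : (s <= h)%N -> (0 < a + (b - s))%N ->
  Mcut n.+1 h.+1 a.+1 b c i.+1 s.+1 - Mcut n.+1 h.+1 a b.+1 c i.+1 s.+1 =
  - x ^ (2 * n.+1%:Z - h.+1%:Z - 1 - b%:Z - 2 * c%:Z) * Mcut n h a b c i s.
Proof.
move=> le_sh ab_gt0.
have [le_sb|lt_bs] := leqP s b; last first.
  by rewrite /Mcut !ifF ?subr0 ?mulr0 //; apply/negbTE; lia.
have Pn0 := P_neq0; have x0 := mq_neq0.
rewrite !McutE // !subSS.
have -> : h.+1%:Z + 1 - s.+1%:Z = h%:Z + 1 - s%:Z by lia.
set K := C q _ a _ (c + s - i).
rewrite [C q _ a (b - s) _](@C_addE _ _ _ _ a (b - s) (c + s - i)) // -/K.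
(* At [s = b] the truncated [b - s.+1] breaks the equality of the two [C] values, but there
   [Pfall b s.+1] is 0. *)
have CK : C q (h%:Z + 1 - s%:Z) a.+1 (b - s.+1) (c + s.+1 - i.+1)
    * Pfall b s.+1 = K * Pfall b s.+1.
  rewrite /Pfall; case: ifP => lt_sb; last by rewrite !mulr0.
  by rewrite (@C_addE _ _ _ _ a (b - s) (c + s - i)) //; lia.
rewrite -[_ * _ * Pfall b s.+1]mulrA CK mulrA -mulrBr Pfall_diff MexpSS.
have -> : 2 * n.+1%:Z - h.+1%:Z - 1 - b%:Z - 2 * c%:Z =
  (2 * n%:Z - h%:Z - 2 * c%:Z - s%:Z) + - (b - s)%N%:Z by lia.
rewrite [Mexp n h c i s + _ - _ - _ - _](_ : _ =
  Mexp n h c i s + (2 * n%:Z - h%:Z - 2 * c%:Z - s%:Z)); last lia.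
move: (Mexp _ _ _ _ _) (2 * _ - _ - _ - _) => e1 e2.
rewrite !expfzDr // -exprnN PS addSn addnS 2!(exprS (-1)).
(* The factor [1 - u] coming from [Pfall_diff] cancels the last factor of [P q s.+1] in the
   denominator. *)
move: (x ^- s.+1) (one_sub_mqVn_neq0 s.+1 isT) => u u1; move: (x ^- (b - s)) => v.
field; do ?[apply/andP; split]; do ?exact: Pn0; exact: u1.
Qed.

(** The hypothesis keeps [a + (b - s)] positive for every [s <= h]. The terms at [s = 0] cancel, and
    both indices are then shifted by one. *)
Lemma Dsum_diff n h a b c : (0 < a)%N || (h < b)%N ->
  Dsum q n.+1 h.+1 a.+1 b c - Dsum q n.+1 h.+1 a b.+1 c =
  - x ^ (2 * n.+1%:Z - h.+1%:Z - 1 - b%:Z - 2 * c%:Z) * Dsum q n h a b c.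
Proof.
move=> ab; rewrite !Dsum_cut.
rewrite (@big_nat_recl _ _ _ h.+1) //.
rewrite [in X in _ - X](@big_nat_recl _ _ _ h.+1) //=.
rewrite [X in X + _ - _](eq_bigr _ (fun i _ => Mcut_s0 _ _ _ _ _ i)).
rewrite opprD addrACA subrr add0r -sumrB mulr_sumr.
apply: eq_big_nat => s /andP[_]; rewrite ltnS => le_sh.
rewrite -sumrB mulr_sumr addSn minnSS big_add1 /=.
by apply: eq_bigr => i _; apply: Mcut_diff => //; lia.
Qed.

Lemma Dsum_diff_h0 n a b c : Dsum q n 0 a.+1 b c = Dsum q n 0 a b.+1 c.
Proof. by rewrite !Dsum_cut !big_nat1 Mcut_s0. Qed.

End TermIdentity.

Theorem theorem9p4 (p f q : nat)
    (p_prime : prime p) (p_odd : odd p) (f_gt0 : (0 < f)%N)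
    (q_def : q = (p ^ f)%N)
    (n h a b c : nat)
    (le_n : [/\ (a <= n)%N, (b <= n)%N, (c <= n)%N & (h <= n)%N])
    (sum_abc : (a + b + c)%N = n)
    (c_le : (c <= n - h)%N) (a_ge1 : (1 <= a)%N)
    (neq : ((a - 1)%N, (b + 1)%N, c) <> (0%N, h, (n - h)%N)) :
  D q n h%:Z a b c - D q n h%:Z (a - 1) (b + 1) c =
  - mq q ^ (2 * n%:Z - h%:Z - 1 - b%:Z - 2 * c%:Z)
    * D q (n - 1) (h%:Z - 1) (a - 1) b c.
Proof.
have q_gt1 : (1 < q)%N by rewrite q_def -(expn0 p) ltn_exp2l // prime_gt1.
case: le_n => _ _ _ le_hn; case: a a_ge1 sum_abc neq => // a _ sum_abc.
case: n le_hn sum_abc c_le => [|n] le_hn sum_abc c_le; first lia.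
rewrite !subn1 !addn1 /= => neq.
(* If [a = 0] and [b < h], then [c <= n.+1 - h] and [b + c = n] force [b.+1 = h], the excluded
   triple. *)
have ab : (0 < a)%N || (h <= b)%N.
  case: a sum_abc neq => //= sum_abc neq; rewrite leqNgt.
  apply/negP => lt_bh; apply: neq; congr (_, _, _); lia.
case: h le_hn c_le neq ab => [|h] le_hn c_le _ ab.
  by rewrite /= ?ltn0 ?andbF !addr0 Dsum_diff_h0 // subrr mulr0.
rewrite (_ : h.+1%:Z - 1 = h%:Z) /=; last lia.
(* A correction needs first argument 0 and second argument below the index; [ab] rules this out in
   the two remaining places. *)
rewrite !ifF ?addr0; first exact: Dsum_diff.
- by apply/negbTE; lia.
- by apply/negbTE; lia.
Qed.
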